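(* (i) For positive integers $L,L'$ not depending on $q$, $T_{\rm rel}(L')\succ T_{\rm rel}(L)$ if and only if $\lceil\log_2L'\rceil>\lceil\log_2L\rceil$. (ii) For every $\gamma\in(0,1)$ there exists $\lambda=\lambda(\gamma)>1$ such that for every $d>0$, with $L=\lfloor d/q^\gamma\rfloor$, one has $T_{\rm rel}(\lfloor\lambda L\rfloor)\succ T_{\rm rel}(L)$. Moreover, if $\gamma<1/2$ one may take $\lambda=2$.
   Context: Fix $q\in(0,1/2)$, $p=1-q$. $T_{\rm rel}(L)$ denotes the relaxation time (inverse spectral gap) of the East process on $\Lambda=\{1,\dots,L\}$: the Markov chain on $\{0,1\}^\Lambda$ with generator $\mathcal L f(\sigma)=\sum_{x\in\Lambda}c_x(\sigma)[\pi_x(f)-f](\sigma)$, $c_1\equiv1$, $c_x(\sigma)=1-\sigma_{x-1}$ for $x\ge2$, where $\pi_x(f)$ averages $f$ over $\sigma_x\sim$ Bernoulli$(p)$ (i.e. $\sigma_x=1$ w.p. $p$); the reversible measure is the product Bernoulli$(p)$ measure $\pi$, and the gap is $\inf_f \sum_x\pi(c_x\mathrm{Var}_x f)/\mathrm{Var}_\pi(f)$. For positive functions $f,h$ of $q\in(0,1)$, $f\succ h$ means that there is $\beta>0$ with $\liminf_{q\downarrow0}q^{\beta}f(q)/h(q)>0$. *)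

(* Defs.v *)
From Stdlib Require Import Reals Lra Lia List Arith ZArith ClassicalEpsilon.
Open Scope R_scope.

(** Configurations on Lambda = {1,...,L}: a list of booleans of length L,
    where position x (1-indexed) is [nth (x-1) sigma false], and
    [true] means sigma_x = 1. *)

Fixpoint configs (L : nat) : list (list bool) :=
  match L with
  | O => nil :: nil
  | S n => map (cons true) (configs n) ++ map (cons false) (configs n)
  end.

Definition site (sigma : list bool) (x : nat) : bool := nth (x - 1) sigma false.

Fixpoint set_nth_b (s : list bool) (i : nat) (b : bool) : list bool :=
  match s, i with
  | nil, _ => nil
  | _ :: t, O => b :: t
  | a :: t, S j => a :: set_nth_b t j b
  end.
Definition set_site (sigma : list bool) (x : nat) (b : bool) : list bool :=
  set_nth_b sigma (x - 1) b.

Definition bern (q : R) (b : bool) : R := if b then 1 - q else q.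

Definition pi_meas (q : R) (sigma : list bool) : R :=
  fold_right (fun b acc => bern q b * acc) 1 sigma.

Definition sumR {A} (l : list A) (F : A -> R) : R :=
  fold_right (fun a acc => F a + acc) 0 l.

Definition Epi (q : R) (L : nat) (f : list bool -> R) : R :=
  sumR (configs L) (fun s => pi_meas q s * f s).
Definition Varpi (q : R) (L : nat) (f : list bool -> R) : R :=
  Epi q L (fun s => f s ^ 2) - (Epi q L f) ^ 2.

Definition pix (q : R) (x : nat) (f : list bool -> R) (sigma : list bool) : R :=
  bern q true * f (set_site sigma x true) + bern q false * f (set_site sigma x false).

Definition Varx (q : R) (x : nat) (f : list bool -> R) (sigma : list bool) : R :=
  pix q x (fun s => f s ^ 2) sigma - (pix q x f sigma) ^ 2.

(** East constraint: c_1 = 1, c_x = 1 - sigma_{x-1} for x >= 2 *)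
Definition cx (x : nat) (sigma : list bool) : R :=
  if Nat.leb x 1 then 1 else (if site sigma (x - 1) then 0 else 1).

Definition Dir (q : R) (L : nat) (f : list bool -> R) : R :=
  sumR (seq 1 L) (fun x => Epi q L (fun s => cx x s * Varx q x f s)).

Definition is_glb (E : R -> Prop) (g : R) : Prop :=
  (forall r, E r -> g <= r) /\ (forall b, (forall r, E r -> b <= r) -> b <= g).

Definition rayleigh (q : R) (L : nat) (r : R) : Prop :=
  exists f : list bool -> R, Varpi q L f <> 0 /\ r = Dir q L f / Varpi q L f.

Definition gap (q : R) (L : nat) : R :=
  epsilon (inhabits 0) (fun g => is_glb (rayleigh q L) g).

Definition Trel (q : R) (L : nat) : R := / gap q L.

(** f ≻ h : exists beta > 0 with liminf_{q -> 0+} q^beta f(q)/h(q) > 0,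
    i.e. q^beta f(q)/h(q) is eventually bounded below by some c > 0. *)
Definition succ (f h : R -> R) : Prop :=
  exists beta, 0 < beta /\
  exists c, 0 < c /\ exists delta, 0 < delta /\
  forall q, 0 < q < delta -> c <= Rpower q beta * f q / h q.

(** floor of a real, as a nat (0 for negative arguments) *)
Definition nfloor (x : R) : nat := Z.to_nat (Int_part x).

Definition part_ii (gamma lambda : R) : Prop :=
  forall d, 0 < d ->
    succ (fun q => Trel q (nfloor (lambda * INR (nfloor (d / Rpower q gamma)))))
         (fun q => Trel q (nfloor (d / Rpower q gamma))).

(* Main.v *)
Require Import Defs.
From Stdlib Require Import Reals Arith ZArith Lra Lia List Classical ClassicalEpsilon.
Import ListNotations.
Open Scope R_scope.

(** Let [C_L] be the infimum, over functions [v] on [L - 1] sites equal to 1 at the full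
    configuration, of the Dirichlet form of [v] plus the mass [E(v^2; last site empty)] ([killed]
    below).  Conditioning on the leftmost empty site gives [Trel(L) <= L / C_L]; the test function
    [v * 1{site L empty}] gives [Trel(L) >= (1-q)^L / C_L].  The key point is that a good [v] on
    [n] sites yields a good one on [2n] sites at relative cost [4nq] ([barrier_double]), so each
    doubling of [L] multiplies the lower bound on [Trel] by [1/(4qL)] at least.  For
    [L ~ q^(-gamma)], [k] doublings gain [q^(-k(1-gamma))] and the factor [L] loses [q^(-gamma)].
    For fixed [L] the same recursion, together with the elementary bound
    [Trel(2L) <= (2/q) Trel(L)], gives [Trel(L)] of order [q^(-log2_up L)]. *)

(** The infimum lives on [L - 1] sites because the constraint at site [L] reads only site [L - 1]:
    the last site enters the energy through the difference of the function across it, and the square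
    of that difference is charged exactly when site [L - 1] is empty. This charge is the killing
    term. When [L] grows as [q] tends to 0, no explicit asymptotics of [Trel q L] are derived. Both
    [Trel q L] and [Trel q (2 ^ k * L)] are compared with one unknown capacity, which cancels in the
    ratio. Only polynomial losses in [1 / q] are then affordable, so the upper bound may lose [L]
    but not a constant raised to the power [L]; this forces the lossless step in the last site and
    the additive accounting over the leftmost empty site. *)

(** * Expectation under the product measure *)

Lemma sumR_ext {A} (l : list A) (F G : A -> R) :
  (forall a, In a l -> F a = G a) -> sumR l F = sumR l G.
Proof.
  induction l as [|a l IH]; intros H; simpl; [reflexivity|].
  rewrite (H a) by (left; reflexivity). f_equal. apply IH. intros; apply H; now right.
Qed.

Lemma sumR_app {A} (l1 l2 : list A) (F : A -> R) :
  sumR (l1 ++ l2) F = sumR l1 F + sumR l2 F.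
Proof. induction l1 as [|a l IH]; simpl; [|rewrite IH]; lra. Qed.

Lemma sumR_map {A B} (h : A -> B) (l : list A) (F : B -> R) :
  sumR (map h l) F = sumR l (fun a => F (h a)).
Proof. induction l as [|a l IH]; simpl; [|rewrite IH]; reflexivity. Qed.

Lemma sumR_scal {A} (l : list A) (c : R) (F : A -> R) :
  sumR l (fun a => c * F a) = c * sumR l F.
Proof. induction l as [|a l IH]; simpl; [|rewrite IH]; lra. Qed.

Lemma sumR_plus {A} (l : list A) (F G : A -> R) :
  sumR l (fun a => F a + G a) = sumR l F + sumR l G.
Proof. induction l as [|a l IH]; simpl; [|rewrite IH]; lra. Qed.

Lemma Epi_S (q : R) (n : nat) (f : list bool -> R) :
  Epi q (S n) f = (1 - q) * Epi q n (fun s => f (true :: s))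
                  + q * Epi q n (fun s => f (false :: s)).
Proof.
  unfold Epi. simpl. rewrite sumR_app, !sumR_map, <- !sumR_scal.
  f_equal; apply sumR_ext; intros; simpl; ring.
Qed.

Lemma Epi_0 (q : R) (f : list bool -> R) : Epi q 0 f = f [].
Proof. unfold Epi; simpl; ring. Qed.

Lemma Epi_ext (q : R) (n : nat) (f g : list bool -> R) :
  (forall s, length s = n -> f s = g s) -> Epi q n f = Epi q n g.
Proof.
  revert f g; induction n as [|n IH]; intros f g H.
  - rewrite !Epi_0. now apply H.
  - rewrite !Epi_S. f_equal; f_equal; apply IH; intros; apply H; simpl; lia.
Qed.

Lemma Epi_plus (q : R) (n : nat) (f g : list bool -> R) :
  Epi q n (fun s => f s + g s) = Epi q n f + Epi q n g.
Proof.
  unfold Epi. rewrite <- sumR_plus. apply sumR_ext; intros; ring.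
Qed.

Lemma Epi_scal (q : R) (n : nat) (c : R) (f : list bool -> R) :
  Epi q n (fun s => c * f s) = c * Epi q n f.
Proof.
  unfold Epi. rewrite <- sumR_scal. apply sumR_ext; intros; ring.
Qed.

Lemma Epi_const (q : R) (n : nat) (c : R) : Epi q n (fun _ => c) = c.
Proof.
  induction n as [|n IH]; [apply Epi_0|]. rewrite Epi_S, IH. ring.
Qed.

Lemma Epi_le (q : R) (n : nat) (f g : list bool -> R) :
  0 < q < 1 -> (forall s, length s = n -> f s <= g s) -> Epi q n f <= Epi q n g.
Proof.
  intros Hq; revert f g; induction n as [|n IH]; intros f g H.
  - rewrite !Epi_0. now apply H.
  - rewrite !Epi_S. apply Rplus_le_compat; apply Rmult_le_compat_l; try lra;
      apply IH; intros; apply H; simpl; lia.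
Qed.

Lemma Epi_nonneg (q : R) (n : nat) (f : list bool -> R) :
  0 < q < 1 -> (forall s, length s = n -> 0 <= f s) -> 0 <= Epi q n f.
Proof.
  intros Hq H. rewrite <- (Epi_const q n 0). now apply Epi_le.
Qed.

Lemma Epi_app (q : R) (n m : nat) (f : list bool -> R) :
  Epi q (n + m) f = Epi q n (fun s => Epi q m (fun r => f (s ++ r))).
Proof.
  revert f; induction n as [|n IH]; intros f.
  - rewrite Epi_0. reflexivity.
  - simpl (S n + m)%nat. rewrite !Epi_S, !IH. reflexivity.
Qed.

Lemma Epi_swap (q : R) (n m : nat) (F : list bool -> list bool -> R) :
  Epi q n (fun s => Epi q m (fun r => F s r)) = Epi q m (fun r => Epi q n (fun s => F s r)).
Proof.
  revert F; induction n as [|n IH]; intros F.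
  - rewrite Epi_0. apply Epi_ext; intros; now rewrite Epi_0.
  - rewrite Epi_S, !IH, <- !Epi_scal, <- Epi_plus. apply Epi_ext; intros; now rewrite Epi_S.
Qed.

Lemma Varpi_nonneg (q : R) (n : nat) (f : list bool -> R) :
  0 < q < 1 -> 0 <= Varpi q n f.
Proof.
  intros Hq. unfold Varpi. set (m := Epi q n f).
  assert (H : Epi q n (fun s => (f s - m) ^ 2) = Epi q n (fun s => f s ^ 2) - m ^ 2).
  { rewrite (Epi_ext q n _ (fun s => f s ^ 2 + ((-2 * m) * f s + m ^ 2))) by (intros; ring).
    rewrite !Epi_plus, Epi_scal, Epi_const. fold m. ring. }
  rewrite <- H. apply Epi_nonneg; [assumption|]. intros; apply pow2_ge_0.
Qed.

(** * Dirichlet form with a left boundary, and its killed version *)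

(** [b] is the state of the site to the left of the block: [false] makes the first site free. *)
Fixpoint dirichlet (q : R) (n : nat) (b : bool) (f : list bool -> R) : R :=
  match n with
  | O => 0
  | S m =>
      (if b then 0
       else q * (1 - q) * Epi q m (fun s => (f (true :: s) - f (false :: s)) ^ 2))
      + (1 - q) * dirichlet q m true (fun s => f (true :: s))
      + q * dirichlet q m false (fun s => f (false :: s))
  end.

(** With the default [b], the site left of the block stands in for the last site of an empty block,
    so boundary states compose under concatenation. *)
Fixpoint last_site (b : bool) (s : list bool) : bool :=
  match s with
  | [] => b
  | a :: t => last_site a t
  end.

(** An empty last site is precisely what would allow a site appended on the right to flip. *)
Definition exit_mass (q : R) (n : nat) (b : bool) (v : list bool -> R) : R :=
  Epi q n (fun s => if last_site b s then 0 else v s ^ 2).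

(** Dirichlet form of the chain killed at rate 1 while its last site is empty: with [L - 1] sites
    and [b = false], the infimum of [killed v / E v^2] is the spectral gap on [L] sites. *)
Definition killed (q : R) (n : nat) (b : bool) (v : list bool -> R) : R :=
  dirichlet q n b v + exit_mass q n b v.

(** Generalises [cx], so that an induction can remove the first site and make it the new boundary.
    At [b = false] it is convertible with [cx]. *)
Definition boundary_constraint (b : bool) (x : nat) (sigma : list bool) : R :=
  if Nat.leb x 1 then (if b then 0 else 1) else (if site sigma (x - 1) then 0 else 1).

Lemma Varx_eq (q : R) (x : nat) (f : list bool -> R) (s : list bool) :
  Varx q x f s = q * (1 - q) * (f (set_site s x true) - f (set_site s x false)) ^ 2.
Proof. unfold Varx, pix, bern; ring. Qed.

Lemma Dir_boundary (q : R) (L : nat) (b : bool) (f : list bool -> R) :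
  sumR (seq 1 L) (fun x => Epi q L (fun s => boundary_constraint b x s * Varx q x f s))
  = dirichlet q L b f.
Proof.
  revert b f; induction L as [|L IH]; intros b f; [reflexivity|].
  cbn [dirichlet]. rewrite <- !IH. cbn [seq sumR fold_right].
  change (fold_right (fun a acc =>
            Epi q (S L) (fun s => boundary_constraint b a s * Varx q a f s) + acc) 0 (seq 2 L))
    with (sumR (seq 2 L) (fun a => Epi q (S L) (fun s => boundary_constraint b a s * Varx q a f s))).
  rewrite Rplus_assoc. f_equal.
  - rewrite Epi_S. unfold boundary_constraint; simpl Nat.leb; cbv iota.
    assert (G : forall a, Epi q L (fun s => (if b then 0 else 1) * Varx q 1 f (a :: s))
       = (if b then 0 else 1) * (q * (1 - q)
         * Epi q L (fun s => (f (true :: s) - f (false :: s)) ^ 2))).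
    { intros a. rewrite <- !Epi_scal. apply Epi_ext; intros. now rewrite Varx_eq. }
    rewrite !G. destruct b; ring.
  - rewrite <- !sumR_scal, <- sumR_plus, <- (seq_shift L 1), sumR_map.
    apply sumR_ext. intros x Hx. apply in_seq in Hx.
    rewrite Epi_S. destruct x as [|x]; [lia|].
    assert (G : forall a,
      Epi q L (fun s => boundary_constraint b (S (S x)) (a :: s) * Varx q (S (S x)) f (a :: s))
       = Epi q L (fun s => boundary_constraint a (S x) s * Varx q (S x) (fun s0 => f (a :: s0)) s)).
    { intros a. apply Epi_ext. intros s _. rewrite !Varx_eq. f_equal.
      - unfold boundary_constraint, site. destruct x as [|x]; simpl; [reflexivity|].
        now rewrite Nat.sub_0_r.
      - unfold set_site. simpl. rewrite Nat.sub_0_r. reflexivity. }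
    rewrite !G. reflexivity.
Qed.

Lemma Dir_dirichlet (q : R) (L : nat) (f : list bool -> R) :
  Dir q L f = dirichlet q L false f.
Proof. apply (Dir_boundary q L false f). Qed.

Lemma dirichlet_ext (q : R) (n : nat) (b : bool) (f g : list bool -> R) :
  (forall s, length s = n -> f s = g s) -> dirichlet q n b f = dirichlet q n b g.
Proof.
  revert b f g; induction n as [|n IH]; intros b f g H; cbn [dirichlet]; [reflexivity|].
  f_equal; [f_equal|].
  - destruct b; [reflexivity|]. f_equal. apply Epi_ext. intros.
    rewrite !H by (simpl; lia). reflexivity.
  - f_equal. apply IH; intros; apply H; simpl; lia.
  - f_equal. apply IH; intros; apply H; simpl; lia.
Qed.

(** The energy is a positive combination of squared differences, so a pointwise bound on these
    suffices. Two functions on the right cover maxima ([c = 1]) and products of functions with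
    values in [0,1] ([c = 2]); taking one of them constant covers truncation and scaling. *)
Lemma dirichlet_contract (q : R) (n : nat) (b : bool) (c : R) (F f g : list bool -> R) :
  0 < q < 1 ->
  (forall x y, length x = n -> length y = n ->
     (F x - F y) ^ 2 <= c * (f x - f y) ^ 2 + c * (g x - g y) ^ 2) ->
  dirichlet q n b F <= c * dirichlet q n b f + c * dirichlet q n b g.
Proof.
  intros Hq; revert b F f g; induction n as [|n IH]; intros b F f g H; cbn [dirichlet]; [lra|].
  assert (H1 := IH true (fun s => F (true :: s)) (fun s => f (true :: s)) (fun s => g (true :: s))
                 ltac:(intros; apply H; simpl; lia)).
  assert (H0 := IH false (fun s => F (false :: s)) (fun s => f (false :: s)) (fun s => g (false :: s))
                 ltac:(intros; apply H; simpl; lia)).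
  assert (HE : (if b then 0 else q * (1 - q) * Epi q n (fun s => (F (true :: s) - F (false :: s)) ^ 2))
     <= c * (if b then 0 else q * (1 - q) * Epi q n (fun s => (f (true :: s) - f (false :: s)) ^ 2))
      + c * (if b then 0 else q * (1 - q) * Epi q n (fun s => (g (true :: s) - g (false :: s)) ^ 2))).
  { destruct b; [lra|].
    assert (E : Epi q n (fun s => (F (true :: s) - F (false :: s)) ^ 2) <=
       Epi q n (fun s => c * (f (true :: s) - f (false :: s)) ^ 2
                         + c * (g (true :: s) - g (false :: s)) ^ 2)).
    { apply Epi_le; [assumption|]. intros; apply H; simpl; lia. }
    rewrite Epi_plus, !Epi_scal in E.
    apply (Rmult_le_compat_l (q * (1 - q))) in E; nra. }
  apply (Rmult_le_compat_l (1 - q)) in H1; [|lra].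
  apply (Rmult_le_compat_l q) in H0; [|lra].
  lra.
Qed.

Lemma dirichlet_const (q : R) (n : nat) (b : bool) (c : R) : dirichlet q n b (fun _ => c) = 0.
Proof.
  revert b; induction n as [|n IH]; intros b; cbn [dirichlet]; [reflexivity|].
  rewrite !IH, (Epi_ext q n _ (fun _ => 0)) by (intros; ring).
  rewrite Epi_const. destruct b; ring.
Qed.

Lemma dirichlet_nonneg (q : R) (n : nat) (b : bool) (f : list bool -> R) :
  0 < q < 1 -> 0 <= dirichlet q n b f.
Proof.
  intros Hq. revert b f; induction n as [|n IH]; intros b f; cbn [dirichlet]; [lra|].
  assert (H1 := IH true (fun s => f (true :: s))).
  assert (H0 := IH false (fun s => f (false :: s))).
  assert (HE : 0 <= Epi q n (fun s => (f (true :: s) - f (false :: s)) ^ 2))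
    by (apply Epi_nonneg; [assumption|]; intros; apply pow2_ge_0).
  destruct b; [nra|].
  assert (0 <= q * (1 - q)) by nra. nra.
Qed.

Lemma dirichlet_free (q : R) (n : nat) (b : bool) (f : list bool -> R) :
  0 < q < 1 -> dirichlet q n b f <= dirichlet q n false f.
Proof.
  intros Hq. destruct n as [|n]; cbn [dirichlet]; [lra|].
  assert (HE : 0 <= Epi q n (fun s => (f (true :: s) - f (false :: s)) ^ 2))
    by (apply Epi_nonneg; [assumption|]; intros; apply pow2_ge_0).
  assert (0 <= q * (1 - q)) by nra. destruct b; nra.
Qed.

(** Holds for any quadratic form: with [p = 1 - q], p x^2 + q y^2 = (p x + q y)^2 + p q (x -
    y)^2. *)
Lemma dirichlet_parallelogram (q : R) (n : nat) (b : bool) (f g : list bool -> R) :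
  (1 - q) * dirichlet q n b f + q * dirichlet q n b g
  = dirichlet q n b (fun s => (1 - q) * f s + q * g s)
    + q * (1 - q) * dirichlet q n b (fun s => f s - g s).
Proof.
  revert b f g; induction n as [|n IH]; intros b f g; cbn [dirichlet]; [ring|].
  assert (H1 := IH true (fun s => f (true :: s)) (fun s => g (true :: s))).
  assert (H0 := IH false (fun s => f (false :: s)) (fun s => g (false :: s))).
  cbv beta in H1, H0.
  assert (HE : (1 - q) * Epi q n (fun s => (f (true :: s) - f (false :: s)) ^ 2)
     + q * Epi q n (fun s => (g (true :: s) - g (false :: s)) ^ 2)
     = Epi q n (fun s => ((1 - q) * f (true :: s) + q * g (true :: s)
                         - ((1 - q) * f (false :: s) + q * g (false :: s))) ^ 2)
     + q * (1 - q) * Epi q n (fun s => (f (true :: s) - g (true :: s)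
                                    - (f (false :: s) - g (false :: s))) ^ 2)).
  { rewrite <- !Epi_scal, <- !Epi_plus. apply Epi_ext; intros; ring. }
  destruct b.
  - apply (f_equal (Rmult (1 - q))) in H1. apply (f_equal (Rmult q)) in H0. lra.
  - apply (f_equal (Rmult (1 - q))) in H1. apply (f_equal (Rmult q)) in H0.
    apply (f_equal (Rmult (q * (1 - q)))) in HE. lra.
Qed.

(** Constraints look only to the left: the left block evolves independently of the right one, while
    the right block sees the left one only through its last site. *)
Lemma dirichlet_split (q : R) (n m : nat) (b : bool) (F : list bool -> R) :
  dirichlet q (n + m) b F
  = Epi q m (fun r => dirichlet q n b (fun s => F (s ++ r)))
    + Epi q n (fun s => dirichlet q m (last_site b s) (fun r => F (s ++ r))).
Proof.
  revert b F; induction n as [|n IH]; intros b F.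
  - cbn [dirichlet last_site app Nat.add]. rewrite Epi_const, Epi_0. symmetry. apply Rplus_0_l.
  - simpl (S n + m)%nat. cbn [dirichlet]. rewrite !IH, Epi_S, !Epi_plus, !Epi_scal.
    cbn [app last_site].
    assert (HE : Epi q m (fun r => if b then 0 else q * (1 - q) *
         Epi q n (fun s => (F (true :: s ++ r) - F (false :: s ++ r)) ^ 2))
      = if b then 0 else q * (1 - q) *
         Epi q (n + m) (fun s => (F (true :: s) - F (false :: s)) ^ 2)).
    { destruct b; [apply Epi_const|]. rewrite Epi_scal, Epi_app. f_equal. apply Epi_swap. }
    rewrite HE. ring.
Qed.

Lemma last_site_app (b : bool) (s r : list bool) :
  last_site b (s ++ r) = last_site (last_site b s) r.
Proof. revert b; induction s as [|a s IH]; intros b; simpl; auto. Qed.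

Lemma exit_mass_split (q : R) (n m : nat) (b : bool) (F : list bool -> R) :
  exit_mass q (n + m) b F
  = Epi q n (fun s => exit_mass q m (last_site b s) (fun r => F (s ++ r))).
Proof.
  unfold exit_mass. rewrite Epi_app. apply Epi_ext; intros s _. apply Epi_ext; intros r _.
  now rewrite last_site_app.
Qed.

Lemma exit_mass_le (q : R) (n : nat) (b : bool) (f g : list bool -> R) :
  0 < q < 1 -> (forall s, length s = n -> f s ^ 2 <= g s ^ 2) ->
  exit_mass q n b f <= exit_mass q n b g.
Proof.
  intros Hq H. apply Epi_le; [assumption|]. intros s Hs.
  destruct (last_site b s); [lra|auto].
Qed.

Lemma exit_mass_nonneg (q : R) (n : nat) (b : bool) (f : list bool -> R) :
  0 < q < 1 -> 0 <= exit_mass q n b f.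
Proof.
  intros Hq. apply Epi_nonneg; [assumption|]. intros s _.
  destruct (last_site b s); [lra|apply pow2_ge_0].
Qed.

Lemma exit_mass_free (q : R) (n : nat) (b : bool) (f : list bool -> R) :
  0 < q < 1 -> exit_mass q n b f <= exit_mass q n false f.
Proof.
  intros Hq. apply Epi_le; [assumption|].
  intros [|a s] _; simpl; [destruct b; [apply pow2_ge_0|lra]|lra].
Qed.

Lemma exit_mass_S (q : R) (n : nat) (b : bool) (f : list bool -> R) :
  exit_mass q (S n) b f = (1 - q) * exit_mass q n true (fun s => f (true :: s))
                          + q * exit_mass q n false (fun s => f (false :: s)).
Proof. unfold exit_mass. apply Epi_S. Qed.

Lemma killed_nonneg (q : R) (n : nat) (b : bool) (f : list bool -> R) :
  0 < q < 1 -> 0 <= killed q n b f.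
Proof.
  intros Hq. unfold killed.
  assert (H1 := dirichlet_nonneg q n b f Hq). assert (H2 := exit_mass_nonneg q n b f Hq). lra.
Qed.

Lemma killed_free (q : R) (n : nat) (b : bool) (f : list bool -> R) :
  0 < q < 1 -> killed q n b f <= killed q n false f.
Proof.
  intros Hq. unfold killed.
  assert (H1 := dirichlet_free q n b f Hq). assert (H2 := exit_mass_free q n b f Hq). lra.
Qed.

Lemma killed_split (q : R) (n m : nat) (b : bool) (F : list bool -> R) :
  killed q (n + m) b F
  = Epi q m (fun r => dirichlet q n b (fun s => F (s ++ r)))
    + Epi q n (fun s => killed q m (last_site b s) (fun r => F (s ++ r))).
Proof.
  unfold killed. rewrite Epi_plus, dirichlet_split, exit_mass_split. ring.
Qed.

Lemma killed_S_ge (q : R) (n : nat) (b : bool) (f : list bool -> R) :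
  0 < q < 1 ->
  (1 - q) * killed q n true (fun s => f (true :: s))
  + q * killed q n false (fun s => f (false :: s)) <= killed q (S n) b f.
Proof.
  intros Hq. unfold killed. rewrite exit_mass_S. cbn [dirichlet].
  assert (HE : 0 <= Epi q n (fun s => (f (true :: s) - f (false :: s)) ^ 2))
    by (apply Epi_nonneg; [assumption|]; intros; apply pow2_ge_0).
  assert (0 <= q * (1 - q)) by nra. destruct b; nra.
Qed.

(** The ignored sites can only block the first site of the right block, and freeing it adds
    energy. *)
Lemma dirichlet_skipn (q : R) (j m : nat) (b : bool) (F : list bool -> R) :
  0 < q < 1 -> dirichlet q (j + m) b (fun s => F (skipn j s)) <= dirichlet q m false F.
Proof.
  intros Hq. rewrite dirichlet_split.
  rewrite (Epi_ext q m _ (fun _ => 0)).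
  2:{ intros r _. rewrite (dirichlet_ext q j b _ (fun _ => F r)).
      - apply dirichlet_const.
      - intros s Hs. subst j. now rewrite skipn_app, skipn_all, Nat.sub_diag. }
  rewrite Epi_const, Rplus_0_l, <- (Epi_const q j (dirichlet q m false F)).
  apply Epi_le; [assumption|]. intros s Hs.
  rewrite (dirichlet_ext q m _ _ F).
  - now apply dirichlet_free.
  - intros r _. subst j. now rewrite skipn_app, skipn_all, Nat.sub_diag.
Qed.

Lemma killed_skipn (q : R) (j m : nat) (b : bool) (F : list bool -> R) :
  0 < q < 1 -> killed q (j + m) b (fun s => F (skipn j s)) <= killed q m false F.
Proof.
  intros Hq. unfold killed. apply Rplus_le_compat; [now apply dirichlet_skipn|].
  rewrite exit_mass_split, <- (Epi_const q j (exit_mass q m false F)).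
  apply Epi_le; [assumption|]. intros s Hs.
  eapply Rle_trans; [|apply (exit_mass_free q m (last_site b s)); assumption].
  apply exit_mass_le; [assumption|].
  intros r _. subst j. rewrite skipn_app, skipn_all, Nat.sub_diag. apply Rle_refl.
Qed.

(** An equality, unlike [dirichlet_skipn]: sites appended on the right do not constrain those on the
    left. *)
Lemma dirichlet_firstn (q : R) (n m : nat) (b : bool) (F : list bool -> R) :
  dirichlet q (n + m) b (fun s => F (firstn n s)) = dirichlet q n b F.
Proof.
  assert (Hf : forall s r : list bool, length s = n -> firstn n (s ++ r) = s).
  { intros s r <-. now rewrite firstn_app, firstn_all, Nat.sub_diag, app_nil_r. }
  rewrite dirichlet_split, (Epi_ext q m _ (fun _ => dirichlet q n b F)).
  2:{ intros r _. apply dirichlet_ext. intros s Hs. now rewrite Hf. }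
  rewrite (Epi_ext q n _ (fun _ => 0)), !Epi_const; [ring|].
  intros s Hs. rewrite (dirichlet_ext q m _ _ (fun _ => F s)).
  - apply dirichlet_const.
  - intros r _. now rewrite Hf.
Qed.

Lemma Epi_skipn (q : R) (j m : nat) (F : list bool -> R) :
  Epi q (j + m) (fun s => F (skipn j s)) = Epi q m F.
Proof.
  rewrite Epi_app, (Epi_ext q j _ (fun _ => Epi q m F)); [apply Epi_const|].
  intros s <-. apply Epi_ext. intros r _. now rewrite skipn_app, skipn_all, Nat.sub_diag.
Qed.

Lemma Epi_snoc (q : R) (n : nat) (f : list bool -> R) :
  Epi q (n + 1) f = Epi q n (fun s => (1 - q) * f (s ++ [true]) + q * f (s ++ [false])).
Proof. rewrite Epi_app. apply Epi_ext. intros s _. now rewrite Epi_S, !Epi_0. Qed.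

(** Origin of the killing: flips of the appended site cost the exit mass of the discrepancy across
    it. *)
Lemma dirichlet_snoc (q : R) (n : nat) (b : bool) (f : list bool -> R) :
  dirichlet q (n + 1) b f
  = (1 - q) * dirichlet q n b (fun s => f (s ++ [true]))
    + q * dirichlet q n b (fun s => f (s ++ [false]))
    + q * (1 - q) * exit_mass q n b (fun s => f (s ++ [true]) - f (s ++ [false])).
Proof.
  rewrite dirichlet_split, Epi_S, !Epi_0. f_equal.
  unfold exit_mass. rewrite <- Epi_scal. apply Epi_ext. intros s _.
  cbn [dirichlet]. rewrite Epi_0. destruct (last_site b s); ring.
Qed.

(** * Poincaré inequalities for the killed form *)

Definition poincare_killed (q : R) (n : nat) (k : R) : Prop :=
  forall v, Epi q n (fun s => v s ^ 2) <= k * killed q n false v.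

(** A function on [m] sites is read on the last [m] of [n] sites, which keeps its mass and does not
    raise its killed form. *)
Lemma poincare_killed_le (q : R) (m n : nat) (k : R) :
  0 < q < 1 -> (m <= n)%nat -> 0 <= k -> poincare_killed q n k -> poincare_killed q m k.
Proof.
  intros Hq Hmn Hk H v. replace n with (n - m + m)%nat in H by lia.
  specialize (H (fun s => v (skipn (n - m) s))).
  assert (HE := Epi_skipn q (n - m) m (fun s => v s ^ 2)). cbv beta in H, HE. rewrite HE in H.
  eapply Rle_trans; [exact H|]. apply Rmult_le_compat_l; [assumption|].
  now apply killed_skipn.
Qed.

(** No loss in [n]: by [dirichlet_parallelogram] the energy splits orthogonally between the
    average over the last site and the discrepancy at the last site. *)
Lemma poincare_of_killed (q : R) (n : nat) (k : R) (f : list bool -> R) :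
  0 < q < 1 -> (forall m, (m < n)%nat -> poincare_killed q m k) ->
  Varpi q n f <= k * dirichlet q n false f.
Proof.
  intros Hq. revert f; induction n as [|n IH]; intros f H.
  - unfold Varpi. rewrite !Epi_0. cbn. lra.
  - replace (S n) with (n + 1)%nat by lia.
    set (a := fun s => f (s ++ [true])). set (c := fun s => f (s ++ [false])).
    assert (HV : Varpi q (n + 1) f = q * (1 - q) * Epi q n (fun s => (a s - c s) ^ 2)
                   + Varpi q n (fun s => (1 - q) * a s + q * c s)).
    { assert (HE : Epi q n (fun s => (1 - q) * f (s ++ [true]) ^ 2 + q * f (s ++ [false]) ^ 2)
         = q * (1 - q) * Epi q n (fun s => (a s - c s) ^ 2)
           + Epi q n (fun s => ((1 - q) * a s + q * c s) ^ 2)).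
      { rewrite <- Epi_scal, <- Epi_plus. apply Epi_ext; intros; unfold a, c; ring. }
      unfold Varpi. rewrite !Epi_snoc, HE. unfold a, c. ring. }
    rewrite HV, dirichlet_snoc. fold a c. rewrite dirichlet_parallelogram.
    assert (HK := H n ltac:(lia) (fun s => a s - c s)). unfold killed in HK.
    assert (HT := IH (fun s => (1 - q) * a s + q * c s) ltac:(intros; apply H; lia)).
    apply (Rmult_le_compat_l (q * (1 - q))) in HK; [|nra].
    change (exit_mass q n false (fun s => f (s ++ [true]) - f (s ++ [false])))
      with (exit_mass q n false (fun s => a s - c s)).
    cbv beta in HK. lra.
Qed.

(** Conditioning on the leftmost empty site, which acts as an empty left boundary for the
    sites to its right; the only configuration without such a site contributes the first term. *)
Lemma mass_le_full_config (q : R) (n : nat) (b : bool) (k : R) (v : list bool -> R) :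
  0 < q < 1 -> 0 <= k -> (forall m, (m < n)%nat -> poincare_killed q m k) ->
  Epi q n (fun s => v s ^ 2) <= v (repeat true n) ^ 2 + k * killed q n b v.
Proof.
  intros Hq Hk. revert b v; induction n as [|n IH]; intros b v H.
  - rewrite Epi_0. simpl repeat.
    assert (HN := killed_nonneg q 0 b v Hq). nra.
  - rewrite Epi_S. simpl repeat.
    assert (H0 := H n ltac:(lia) (fun s => v (false :: s))).
    assert (H1 := IH true (fun s => v (true :: s)) ltac:(intros; apply H; lia)).
    assert (HS := killed_S_ge q n b v Hq). cbv beta in H0, H1.
    apply (Rmult_le_compat_l k) in HS; [|assumption].
    apply (Rmult_le_compat_l q) in H0; [|lra].
    apply (Rmult_le_compat_l (1 - q)) in H1; [|lra].
    assert (0 <= v (true :: repeat true n) ^ 2) by apply pow2_ge_0.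
    nra.
Qed.

Lemma poincare_killed_0 (q : R) : poincare_killed q 0 1.
Proof.
  intros v. rewrite Epi_0. unfold killed, exit_mass. rewrite Epi_0. simpl. lra.
Qed.

(** The [S n] contains a middle site between two blocks of [n]. If it is empty, the right block has
    a free boundary and the hypothesis applies to it ([A0]). If it is full, compare with the
    configuration where it is emptied: the discrepancy [g], as a function of the left block, is
    killed when the last site of that block is empty, because the middle site can then flip. So the
    hypothesis applies again ([G]). An empty middle site has probability [q], which costs [1 / q];
    the 2 comes from [HA]. *)
Lemma poincare_killed_double (q : R) (n : nat) (k : R) :
  0 < q < 1 -> 0 <= k -> poincare_killed q n k -> poincare_killed q (n + S n) (2 / q * k).
Proof.
  intros Hq Hk H v. rewrite killed_split.
  set (g := fun s r => v (s ++ true :: r) - v (s ++ false :: r)).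
  set (A0 := Epi q n (fun s => Epi q n (fun r => v (s ++ false :: r) ^ 2))).
  set (A1 := Epi q n (fun s => Epi q n (fun r => v (s ++ true :: r) ^ 2))).
  set (G := Epi q n (fun s => Epi q n (fun r => g s r ^ 2))).
  assert (Hmass : Epi q (n + S n) (fun s => v s ^ 2) = (1 - q) * A1 + q * A0).
  { rewrite Epi_app. unfold A0, A1. rewrite <- !Epi_scal, <- Epi_plus.
    apply Epi_ext. intros s _. apply Epi_S. }
  assert (HA : A1 <= 2 * A0 + 2 * G).
  { unfold A0, A1, G. rewrite <- !Epi_scal, <- Epi_plus. apply Epi_le; [assumption|]. intros s _.
    rewrite <- !Epi_scal, <- Epi_plus. apply Epi_le; [assumption|]. intros r _. unfold g.
    assert (0 <= (v (s ++ true :: r) - 2 * v (s ++ false :: r)) ^ 2) by apply pow2_ge_0. nra. }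
  set (E1 := Epi q n (fun r => dirichlet q n false (fun s => g s r))).
  set (E2 := Epi q n (fun s => Epi q n (fun r => if last_site false s then 0 else g s r ^ 2))).
  set (E3 := Epi q n (fun s => killed q n false (fun r => v (s ++ false :: r)))).
  assert (HG : G <= k * (E1 + E2)).
  { unfold G, E1, E2. rewrite Epi_swap,
      (Epi_swap q n n (fun s r => if last_site false s then 0 else g s r ^ 2)).
    rewrite <- Epi_plus, <- Epi_scal. apply Epi_le; [assumption|]. intros r _.
    apply (H (fun s => g s r)). }
  assert (HA0 : A0 <= k * E3).
  { unfold A0, E3. rewrite <- Epi_scal. apply Epi_le; [assumption|]. intros s _.
    apply (H (fun r => v (s ++ false :: r))). }
  assert (HD : q * (1 - q) * E1 <= Epi q (S n) (fun r => dirichlet q n false (fun s => v (s ++ r)))).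
  { rewrite Epi_S. unfold E1. rewrite <- !Epi_scal, <- Epi_plus.
    apply Epi_le; [assumption|]. intros r _. rewrite dirichlet_parallelogram.
    assert (HN := dirichlet_nonneg q n false
      (fun s => (1 - q) * v (s ++ true :: r) + q * v (s ++ false :: r)) Hq).
    unfold g. lra. }
  (* The middle site is the first site of the right-hand block: its own flips give [E2], and the
     configurations where it is empty give [E3]. *)
  assert (HK : q * (1 - q) * E2 + q * E3
     <= Epi q n (fun s => killed q (S n) (last_site false s) (fun r => v (s ++ r)))).
  { unfold E2, E3. rewrite <- !Epi_scal, <- Epi_plus. apply Epi_le; [assumption|]. intros s _.
    unfold killed at 2. rewrite exit_mass_S. cbn [dirichlet]. unfold killed, g.
    assert (H1 := dirichlet_nonneg q n true (fun r => v (s ++ true :: r)) Hq).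
    assert (H2 := exit_mass_nonneg q n true (fun r => v (s ++ true :: r)) Hq).
    destruct (last_site false s); [rewrite Epi_const|]; nra. }
  rewrite Hmass.
  set (D := Epi q (S n) (fun r => dirichlet q n false (fun s => v (s ++ r)))) in *.
  set (K := Epi q n (fun s => killed q (S n) (last_site false s) (fun r => v (s ++ r)))) in *.
  assert (HDK : q * (1 - q) * (E1 + E2) + q * E3 <= D + K) by lra.
  apply (Rmult_le_compat_l k) in HDK; [|assumption].
  apply (Rmult_le_compat_l (q * (1 - q))) in HG; [|nra].
  apply (Rmult_le_compat_l q) in HA0; [|lra].
  assert (HF : q * (1 - q) * G + q * A0 <= k * (D + K)) by lra.
  assert (HG0 : 0 <= A0).
  { apply Epi_nonneg; [assumption|]. intros. apply Epi_nonneg; [assumption|]. intros. apply pow2_ge_0. }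
  apply Rmult_le_reg_l with q; [lra|].
  replace (q * (2 / q * k * (D + K))) with (2 * (k * (D + K))) by (field; lra).
  apply (Rmult_le_compat_l (q * (1 - q))) in HA; [|nra].
  nra.
Qed.

(** The lengths follow n -> 2 n + 1 from 0, so [2 ^ m - 1] killed sites match [2 ^ m] sites of the
    East chain. *)
Lemma poincare_killed_pow2 (q : R) (m : nat) :
  0 < q < 1 -> poincare_killed q (2 ^ m - 1) ((2 / q) ^ m).
Proof.
  intros Hq. induction m as [|m IH]; [apply poincare_killed_0|].
  assert (Hp : (1 <= 2 ^ m)%nat) by (apply Nat.neq_0_lt_0, Nat.pow_nonzero; lia).
  replace (2 ^ S m - 1)%nat with (2 ^ m - 1 + S (2 ^ m - 1))%nat by (simpl; lia).
  apply (poincare_killed_double q _ _ Hq); [|assumption].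
  apply pow_le. apply Rlt_le, Rdiv_lt_0_compat; lra.
Qed.

(** * Barriers: test functions bounding the capacity of the full configuration from above *)

(** Values are confined to [0,1] so that products and maxima of barriers can be handled by
    [dirichlet_contract]. *)
Definition barrier (q : R) (n : nat) (e : R) : Prop :=
  exists v, v (repeat true n) = 1 /\ (forall s, 0 <= v s <= 1) /\ killed q n false v <= e.

Definition clamp (x : R) : R := Rmax 0 (Rmin 1 x).

Lemma clamp_range (x : R) : 0 <= clamp x <= 1.
Proof. unfold clamp, Rmax, Rmin. destruct (Rle_dec 1 x); destruct Rle_dec; lra. Qed.

Lemma clamp_contract (x y : R) : (clamp x - clamp y) ^ 2 <= (x - y) ^ 2.
Proof.
  assert (H : 0 <= clamp x - clamp y <= x - y \/ x - y <= clamp x - clamp y <= 0).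
  { unfold clamp, Rmax, Rmin. repeat destruct Rle_dec; lra. }
  destruct H; nra.
Qed.

(** Truncation to [0,1] is a contraction fixing 0 and 1, so neither the energy nor the exit mass
    increases. *)
Lemma barrier_of_normalised (q : R) (n : nat) (v : list bool -> R) :
  0 < q < 1 -> v (repeat true n) = 1 -> barrier q n (killed q n false v).
Proof.
  intros Hq Hv. exists (fun s => clamp (v s)). repeat split.
  - rewrite Hv. unfold clamp, Rmax, Rmin. repeat destruct Rle_dec; lra.
  - apply clamp_range.
  - apply clamp_range.
  - unfold killed. apply Rplus_le_compat.
    + assert (HC := dirichlet_contract q n false 1 (fun s => clamp (v s)) v (fun _ => 0) Hq).
      rewrite dirichlet_const in HC. rewrite !Rmult_1_l, Rplus_0_r in HC. apply HC.
      intros x y _ _. assert (H := clamp_contract (v x) (v y)). lra.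
    + apply exit_mass_le; [assumption|]. intros s _.
      assert (H := clamp_contract (v s) 0).
      replace (clamp 0) with 0 in H; [lra|].
      unfold clamp, Rmax, Rmin. repeat destruct Rle_dec; lra.
Qed.

Lemma barrier_weaken (q : R) (m n : nat) (e e' : R) :
  0 < q < 1 -> (m <= n)%nat -> e <= e' -> barrier q m e -> barrier q n e'.
Proof.
  intros Hq Hmn He (v & H1 & H2 & H3).
  exists (fun s => v (skipn (n - m) s)). repeat split; try apply H2.
  - replace n with (n - m + m)%nat at 2 by lia. rewrite repeat_app, skipn_app, repeat_length.
    rewrite skipn_all2, Nat.sub_diag by (rewrite repeat_length; lia). exact H1.
  - assert (HS := killed_skipn q (n - m) m false v Hq).
    replace (n - m + m)%nat with n in HS by lia. lra.
Qed.

Lemma barrier_0 (q : R) : barrier q 0 1.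
Proof.
  exists (fun _ => 1). repeat split; try lra.
  unfold killed, exit_mass. rewrite Epi_0. simpl. lra.
Qed.

(** Starting point of the doubling, which needs a nonempty block. *)
Lemma barrier_1 (q : R) : 0 < q < 1 -> barrier q 1 q.
Proof.
  intros Hq. exists (fun s => if last_site true s then 1 else 0). repeat split.
  - simpl; destruct (last_site true s); lra.
  - simpl; destruct (last_site true s); lra.
  - unfold killed. rewrite exit_mass_S. cbn [dirichlet]. unfold exit_mass.
    rewrite !Epi_0. simpl. nra.
Qed.

(** * The doubling construction *)

(** Used twice: as the test function for the gap, and to measure how stable an empty site is given
    the sites before it. The default [true] gives the empty list the value 0. *)
Definition pin (v : list bool -> R) (s : list bool) : R :=
  if last s true then 0 else v (removelast s).

Lemma dirichlet_pin_eq (q : R) (n : nat) (b : bool) (v : list bool -> R) :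
  dirichlet q (n + 1) b (pin v)
  = q * dirichlet q n b v + q * (1 - q) * exit_mass q n b v.
Proof.
  rewrite dirichlet_snoc.
  rewrite (dirichlet_ext q n b (fun s => pin v (s ++ [true])) (fun _ => 0)).
  2:{ intros s _. unfold pin. now rewrite last_last. }
  rewrite (dirichlet_ext q n b (fun s => pin v (s ++ [false])) v).
  2:{ intros s _. unfold pin. now rewrite last_last, removelast_last. }
  rewrite dirichlet_const. unfold exit_mass.
  rewrite (Epi_ext q n _ (fun s => if last_site b s then 0 else v s ^ 2)); [ring|].
  intros s _. unfold pin. rewrite !last_last, removelast_last.
  destruct (last_site b s); [reflexivity|ring].
Qed.

Lemma dirichlet_pin_le (q : R) (n : nat) (v : list bool -> R) :
  0 < q < 1 -> dirichlet q (n + 1) false (pin v) <= q * killed q n false v.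
Proof.
  intros Hq. rewrite dirichlet_pin_eq. unfold killed.
  assert (H := exit_mass_nonneg q n false v Hq). nra.
Qed.

(** Value of [v] on the [n] sites preceding site [n + j] (counted from 0) if that site is empty. *)
Definition local_stability (n : nat) (v : list bool -> R) (j : nat) (s : list bool) : R :=
  pin v (firstn (n + 1) (skipn j s)).

Definition stability (n : nat) (v : list bool -> R) (js : list nat) (s : list bool) : R :=
  fold_right (fun j acc => Rmax (local_stability n v j s) acc) 0 js.

(** Since [j < n], the window of [n + 1] sites starting at [j] fits into [n + n] sites. The factor
    [q] is the probability that the last site of the window is empty. *)
Lemma dirichlet_local_stability (q : R) (n j : nat) (v : list bool -> R) :
  0 < q < 1 -> (j < n)%nat ->
  dirichlet q (n + n) false (local_stability n v j) <= q * killed q n false v.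
Proof.
  intros Hq Hj. replace (n + n)%nat with (j + (n + 1 + (n - 1 - j)))%nat by lia.
  eapply Rle_trans;
    [apply (dirichlet_skipn q j _ false (fun s => pin v (firstn (n + 1) s)) Hq)|].
  rewrite (dirichlet_firstn q (n + 1) (n - 1 - j) false (pin v)).
  now apply dirichlet_pin_le.
Qed.

(** A difference of maxima lies between the two differences. Consequently the energy of a maximum is
    at most the sum of the energies. *)
Lemma Rmax_contract (a b c d : R) :
  (Rmax a b - Rmax c d) ^ 2 <= 1 * (a - c) ^ 2 + 1 * (b - d) ^ 2.
Proof.
  assert (Hsq : forall u z w, u <= z <= w -> z ^ 2 <= u ^ 2 + w ^ 2).
  { intros u z w H. assert (0 <= u ^ 2) by apply pow2_ge_0. assert (0 <= w ^ 2) by apply pow2_ge_0.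
    destruct (Rle_dec 0 z); nra. }
  destruct (Rle_dec (a - c) (b - d)) as [H|H].
  - assert (H' := Hsq (a - c) (Rmax a b - Rmax c d) (b - d)).
    rewrite !Rmult_1_l. apply H'. unfold Rmax. repeat destruct Rle_dec; lra.
  - assert (H' := Hsq (b - d) (Rmax a b - Rmax c d) (a - c)).
    rewrite !Rmult_1_l, Rplus_comm. apply H'. unfold Rmax. repeat destruct Rle_dec; lra.
Qed.

Lemma dirichlet_stability (q : R) (n : nat) (v : list bool -> R) (js : list nat) :
  0 < q < 1 -> (forall j, In j js -> (j < n)%nat) ->
  dirichlet q (n + n) false (stability n v js) <= INR (length js) * (q * killed q n false v).
Proof.
  intros Hq. induction js as [|j js IH]; intros H.
  - unfold stability. simpl. rewrite dirichlet_const. lra.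
  - assert (H1 := dirichlet_contract q (n + n) false 1 (stability n v (j :: js))
      (local_stability n v j) (stability n v js) Hq
      ltac:(intros; apply Rmax_contract)).
    assert (H2 := dirichlet_local_stability q n j v Hq (H j (or_introl eq_refl))).
    assert (H3 := IH ltac:(intros; apply H; now right)).
    cbn [length]. rewrite S_INR. lra.
Qed.

Lemma stability_range (n : nat) (v : list bool -> R) (js : list nat) (s : list bool) :
  (forall t, 0 <= v t <= 1) -> 0 <= stability n v js s <= 1.
Proof.
  intros Hv. induction js as [|j js IH]; simpl; [lra|]. fold (stability n v js s).
  assert (0 <= local_stability n v j s <= 1).
  { unfold local_stability, pin. destruct last; [lra|apply Hv]. }
  unfold Rmax. destruct Rle_dec; lra.
Qed.

Lemma stability_ge (n : nat) (v : list bool -> R) (js : list nat) (s : list bool) (j : nat) :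
  In j js -> local_stability n v j s <= stability n v js s.
Proof.
  induction js as [|i js IH]; simpl; [tauto|]. intros [->|H].
  - apply Rmax_l.
  - eapply Rle_trans; [apply IH, H|apply Rmax_r].
Qed.

Lemma first_empty_site (r : list bool) :
  r = repeat true (length r) \/ exists j t, r = repeat true j ++ false :: t.
Proof.
  induction r as [|[|] r IH]; simpl.
  - now left.
  - destruct IH as [IH|(j & t & IH)].
    + left. now f_equal.
    + right. exists (S j), t. simpl. now f_equal.
  - right. now exists 0%nat, r.
Qed.

(** The leftmost empty site of [r] is preceded by [n] full sites, where [v] equals 1. *)
Lemma stability_after_full (n : nat) (v : list bool -> R) (r : list bool) :
  v (repeat true n) = 1 -> (forall s, 0 <= v s <= 1) -> length r = n ->
  r <> repeat true n -> stability n v (seq 0 n) (repeat true n ++ r) = 1.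
Proof.
  intros H1 Hv Hr Hne. apply Rle_antisym; [now apply stability_range|].
  destruct (first_empty_site r) as [E|(j & t & E)]; [congruence|].
  assert (Hj : (j < n)%nat).
  { rewrite <- Hr, E, length_app, repeat_length. simpl. lia. }
  eapply Rle_trans; [|apply (stability_ge _ _ _ _ j); apply in_seq; lia].
  unfold local_stability. rewrite E, app_assoc, <- repeat_app, (Nat.add_comm n j), repeat_app.
  rewrite <- !app_assoc, skipn_app, repeat_length, Nat.sub_diag, skipn_all2
    by (rewrite repeat_length; lia).
  cbn [app skipn]. replace (repeat true n ++ false :: t) with ((repeat true n ++ [false]) ++ t)
    by (rewrite <- app_assoc; reflexivity).
  rewrite firstn_app, length_app, repeat_length. cbn [length].
  rewrite Nat.sub_diag, firstn_all2 by (rewrite length_app, repeat_length; simpl; lia).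
  cbn [firstn]. rewrite app_nil_r. unfold pin. rewrite last_last, removelast_last. lra.
Qed.

Lemma stability_full (n : nat) (v : list bool -> R) (js : list nat) (m : nat) :
  stability n v js (repeat true m) = 0.
Proof.
  induction js as [|j js IH]; simpl; [reflexivity|]. fold (stability n v js (repeat true m)).
  rewrite IH. unfold local_stability, pin.
  assert (Hl : forall l, (forall x, In x l -> x = true) -> last l true = true).
  { induction l as [|a l IHl]; intros H; [reflexivity|]. simpl.
    destruct l; [apply H; now left|apply IHl; intros; apply H; now right]. }
  rewrite Hl; [apply Rmax_left; lra|]. intros x Hx.
  apply (repeat_spec m). rewrite <- (firstn_skipn j (repeat true m)). apply in_or_app. right.
  rewrite <- (firstn_skipn (n + 1) (skipn j (repeat true m))). apply in_or_app. now left.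
Qed.

(** Behind a full boundary the full configuration admits no flip, and its last site, or the boundary
    if [n = 0], is full, so there is no exit either. *)
Lemma killed_full_indicator (q : R) (n : nat) (u : list bool -> R) :
  (forall s, length s = n -> s <> repeat true n -> u s = 0) -> killed q n true u = 0.
Proof.
  revert u; induction n as [|n IH]; intros u H.
  - unfold killed, exit_mass. rewrite Epi_0. simpl. ring.
  - assert (H1 := IH (fun s => u (true :: s)) ltac:(intros s Hs Hne; apply H;
      [simpl; lia|simpl; congruence])).
    unfold killed in *. rewrite exit_mass_S. cbn [dirichlet].
    rewrite (dirichlet_ext q n false (fun s => u (false :: s)) (fun _ => 0)), dirichlet_const
      by (intros; apply H; simpl; [lia|congruence]).
    unfold exit_mass at 2.
    rewrite (Epi_ext q n (fun s => if last_site false s then 0 else u (false :: s) ^ 2)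
               (fun _ => 0)), Epi_const.
    2:{ intros s Hs. rewrite H; [destruct last_site; ring|simpl; lia|simpl; congruence]. }
    nra.
Qed.

Definition not_full (s : list bool) : R := if forallb (fun a => a) s then 0 else 1.

Lemma Epi_not_full (q : R) (n : nat) : 0 < q < 1 -> Epi q n not_full <= INR n * q.
Proof.
  intros Hq. induction n as [|n IH].
  - rewrite Epi_0. unfold not_full. simpl. lra.
  - rewrite Epi_S, S_INR.
    change (fun s => not_full (true :: s)) with not_full.
    change (fun s => not_full (false :: s)) with (fun _ : list bool => 1).
    rewrite Epi_const. assert (0 <= INR n) by apply pos_INR. nra.
Qed.

Lemma not_full_cases (s : list bool) :
  (not_full s = 0 /\ s = repeat true (length s)) \/ not_full s = 1.
Proof.
  unfold not_full. destruct (forallb (fun a => a) s) eqn:E; [left|now right].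
  split; [reflexivity|]. destruct (first_empty_site s) as [H|(j & t & H)]; [assumption|].
  rewrite H, forallb_app in E. simpl in E. rewrite Bool.andb_false_r in E. discriminate.
Qed.

Lemma last_site_full (n : nat) (b : bool) : (1 <= n)%nat -> last_site b (repeat true n) = true.
Proof.
  destruct n as [|n]; [lia|]. intros _. simpl. induction n; simpl; auto.
Qed.

(** The barrier on [2 n] sites is [V (1 - S)]: [V] is the old barrier on the right half, and [S]
    is the largest local stability of an empty site of that half.  A legal move can change [V]
    only if some site before it is empty.  If the left half is full then the leftmost empty site is
    perfectly stable, so [1 - S = 0]; hence changes of [V] cost an extra factor [P(left half not
    full) <= n q].  Changes of [S] cost [q] for each of the [n] possible empty sites. *)
Lemma barrier_double (q : R) (n : nat) (e : R) :
  0 < q < 1 -> (1 <= n)%nat -> barrier q n e -> barrier q (n + n) (4 * INR n * q * e).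
Proof.
  intros Hq Hn (v & H1 & Hv & He).
  set (S := stability n v (seq 0 n)).
  set (W := fun s => v (skipn n s) * (1 - S s)).
  assert (HS : forall s, 0 <= S s <= 1) by (intros; now apply stability_range).
  exists W. split; [|split].
  - unfold W, S. rewrite stability_full, repeat_app, skipn_app, repeat_length, Nat.sub_diag.
    rewrite skipn_all2 by (rewrite repeat_length; lia). cbn [app skipn]. rewrite H1. ring.
  - intros s. unfold W. specialize (HS s). specialize (Hv (skipn n s)). nra.
  - assert (Hsk : forall s r : list bool, length s = n -> skipn n (s ++ r) = r).
    { intros s r <-. now rewrite skipn_app, skipn_all, Nat.sub_diag. }
    assert (HD : dirichlet q (n + n) false S <= INR n * (q * killed q n false v)).
    { assert (H := dirichlet_stability q n v (seq 0 n) Hq). rewrite length_seq in H. apply H.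
      intros j Hj. apply in_seq in Hj. lia. }
    assert (Hleft : Epi q n (fun r => dirichlet q n false (fun s => W (s ++ r)))
       <= 2 * Epi q n (fun r => dirichlet q n false (fun s => S (s ++ r)))).
    { rewrite <- Epi_scal. apply Epi_le; [assumption|]. intros r _.
      assert (HC := dirichlet_contract q n false 1 (fun s => W (s ++ r)) (fun s => S (s ++ r))
        (fun _ => 0) Hq).
      assert (HN := dirichlet_nonneg q n false (fun s => S (s ++ r)) Hq).
      rewrite dirichlet_const in HC. eapply Rle_trans; [apply HC|lra].
      intros x y Hx Hy. unfold W. rewrite !Hsk by assumption.
      specialize (Hv r). set (d := S (x ++ r) - S (y ++ r)).
      replace (v r * (1 - S (x ++ r)) - v r * (1 - S (y ++ r))) with (- (v r * d))
        by (unfold d; ring).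
      assert (0 <= d ^ 2) by apply pow2_ge_0. assert (v r ^ 2 <= 1) by nra. nra. }
    assert (Hright : Epi q n (fun s => killed q n (last_site false s) (fun r => W (s ++ r)))
       <= 2 * killed q n false v * Epi q n not_full
          + 2 * Epi q n (fun s => dirichlet q n (last_site false s) (fun r => S (s ++ r)))).
    { rewrite <- !Epi_scal, <- Epi_plus. apply Epi_le; [assumption|]. intros s Hs.
      assert (HN := dirichlet_nonneg q n (last_site false s) (fun r => S (s ++ r)) Hq).
      destruct (not_full_cases s) as [[Hf E]|Hf]; rewrite Hf.
      (* Here [1 <= n] matters: a full nonempty left half blocks the right half, where [W] vanishes
         off the full configuration. *)
      - rewrite Hs in E. rewrite E at 1. rewrite last_site_full by assumption.
        rewrite killed_full_indicator; [lra|]. intros r Hr Hne. unfold W.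
        rewrite E. unfold S. rewrite stability_after_full by assumption. ring.
      - assert (HF := killed_free q n (last_site false s) v Hq).
        assert (HC := dirichlet_contract q n (last_site false s) 2 (fun r => W (s ++ r)) v
          (fun r => S (s ++ r)) Hq).
        assert (HX := exit_mass_le q n (last_site false s) (fun r => W (s ++ r)) v Hq).
        assert (HXN := exit_mass_nonneg q n (last_site false s) v Hq).
        unfold killed in HF |- *. unfold killed.
        assert (HC' := HC ltac:(
          intros x y Hx Hy; unfold W; rewrite !Hsk by assumption;
          generalize (HS (s ++ x)) (HS (s ++ y)) (Hv x) (Hv y);
          generalize (S (s ++ x)) (S (s ++ y)) (v x) (v y);
          intros a c f g Ha Hc Hf' Hg;
          replace (f * (1 - a) - g * (1 - c)) with ((f - g) * (1 - a) + g * (c - a)) by ring;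
          assert (0 <= ((f - g) * (1 - a) - g * (c - a)) ^ 2) by apply pow2_ge_0;
          assert (0 <= (f - g) ^ 2) by apply pow2_ge_0;
          assert (0 <= (a - c) ^ 2) by apply pow2_ge_0;
          assert ((1 - a) ^ 2 <= 1) by nra; assert (g ^ 2 <= 1) by nra;
          assert (((f - g) * (1 - a)) ^ 2 <= (f - g) ^ 2) by
            (rewrite Rpow_mult_distr; nra);
          assert ((g * (c - a)) ^ 2 <= (a - c) ^ 2) by
            (rewrite Rpow_mult_distr; nra);
          nra)).
        assert (HX' := HX ltac:(intros r Hr; unfold W; rewrite Hsk by assumption;
          rewrite Rpow_mult_distr; specialize (HS (s ++ r));
          assert (0 <= v r ^ 2) by apply pow2_ge_0; assert ((1 - S (s ++ r)) ^ 2 <= 1) by nra;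
          nra)).
        lra. }
    (* The constant 4: the changes of the old barrier and those of the stability each contribute at
       most 2 n q times the killed form of [v]. *)
    rewrite killed_split.
    assert (HNF := Epi_not_full q n Hq).
    assert (HK := killed_nonneg q n false v Hq).
    rewrite dirichlet_split in HD.
    assert (0 <= INR n) by apply pos_INR.
    assert (killed q n false v * Epi q n not_full <= killed q n false v * (INR n * q)) by nra.
    assert (INR n * q * killed q n false v <= INR n * q * e)
      by (apply Rmult_le_compat_l; [nra|lra]).
    lra.
Qed.

(** * Relaxation time, killed form and capacity *)

Lemma poincare_killed_exists (q : R) (n : nat) :
  0 < q < 1 -> exists k, 0 < k /\ poincare_killed q n k.
Proof.
  intros Hq. exists ((2 / q) ^ n).
  assert (H2 : 0 < 2 / q) by (apply Rdiv_lt_0_compat; lra).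
  split; [now apply pow_lt|].
  apply (poincare_killed_le q n (2 ^ n - 1)); [assumption| |apply pow_le; lra|].
  - assert (H := Nat.pow_gt_lin_r 2 n ltac:(lia)). lia.
  - now apply poincare_killed_pow2.
Qed.

Lemma Varpi_first_site (q : R) (n : nat) :
  Varpi q (S n) (fun s => if hd true s then 1 else 0) = q * (1 - q).
Proof.
  unfold Varpi. rewrite !Epi_S. cbn [hd]. rewrite !Epi_const. ring.
Qed.

(** [gap] is chosen by [epsilon], so a greatest lower bound must first be shown to exist: [1 / k] is
    a positive lower bound and the first-site indicator makes the set inhabited. *)
Lemma Trel_spec (q : R) (L : nat) (k : R) :
  0 < q < 1 -> (1 <= L)%nat -> 0 < k -> poincare_killed q (L - 1) k ->
  0 < Trel q L /\ Trel q L <= k /\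
  (forall f, Varpi q L f <= Trel q L * Dir q L f).
Proof.
  intros Hq HL Hk HP.
  assert (HV : forall f, Varpi q L f <= k * Dir q L f).
  { intros f. rewrite Dir_dirichlet. apply poincare_of_killed; [assumption|].
    intros m Hm. apply (poincare_killed_le q m (L - 1)); [assumption|lia|lra|assumption]. }
  assert (Hlow : forall r, rayleigh q L r -> / k <= r).
  { intros r (f & Hf & ->). assert (H0 := Varpi_nonneg q L f Hq).
    assert (H := HV f). apply Rmult_le_reg_r with (Varpi q L f); [lra|].
    apply Rmult_le_reg_l with k; [lra|].
    replace (k * (Dir q L f / Varpi q L f * Varpi q L f)) with (k * Dir q L f) by (field; assumption).
    replace (k * (/ k * Varpi q L f)) with (Varpi q L f) by (field; lra). assumption. }
  assert (Hex : exists g, is_glb (rayleigh q L) g).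
  (* Completeness provides suprema, hence the change of sign. *)
  { destruct (completeness (fun x => rayleigh q L (- x))) as [m [Hm1 Hm2]].
    - exists (- / k). intros x Hx. apply Hlow in Hx. lra.
    - destruct L as [|n]; [lia|].
      exists (- (Dir q (S n) (fun s => if hd true s then 1 else 0)
                / Varpi q (S n) (fun s => if hd true s then 1 else 0))).
      exists (fun s => if hd true s then 1 else 0). split; [|lra].
      rewrite Varpi_first_site. nra.
    - exists (- m). split.
      + intros r Hr. assert (- r <= m); [apply Hm1; now rewrite Ropp_involutive|lra].
      + intros b Hb. assert (m <= - b); [|lra]. apply Hm2. intros x Hx. apply Hb in Hx. lra. }
  assert (Hg : is_glb (rayleigh q L) (gap q L))
    by exact (epsilon_spec (inhabits 0) (fun g => is_glb (rayleigh q L) g) Hex).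
  destruct Hg as [Hg1 Hg2].
  assert (Hgk : / k <= gap q L) by (apply Hg2; exact Hlow).
  assert (Hk' : 0 < / k) by (now apply Rinv_0_lt_compat).
  unfold Trel. split; [apply Rinv_0_lt_compat; lra|split].
  - rewrite <- (Rinv_inv k). apply Rinv_le_contravar; assumption.
  - intros f. assert (H0 := Varpi_nonneg q L f Hq).
    destruct (Req_dec (Varpi q L f) 0) as [E|E].
    + rewrite E, Dir_dirichlet. assert (HN := dirichlet_nonneg q L false f Hq).
      assert (0 < / gap q L) by (apply Rinv_0_lt_compat; lra). nra.
    + assert (Hr : gap q L <= Dir q L f / Varpi q L f) by (apply Hg1; exists f; tauto).
      apply Rmult_le_reg_l with (gap q L); [lra|].
      replace (gap q L * (/ gap q L * Dir q L f)) with (Dir q L f) by (field; lra).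
      apply (Rmult_le_compat_r (Varpi q L f)) in Hr; [|lra].
      replace (Dir q L f / Varpi q L f * Varpi q L f) with (Dir q L f) in Hr by (now field).
      assumption.
Qed.

Lemma Trel_pos (q : R) (L : nat) : 0 < q < 1 -> (1 <= L)%nat -> 0 < Trel q L.
Proof.
  intros Hq HL. destruct (poincare_killed_exists q (L - 1) Hq) as (k & Hk & HP).
  now apply (Trel_spec q L k).
Qed.

Lemma Trel_le (q : R) (L : nat) (k : R) :
  0 < q < 1 -> (1 <= L)%nat -> 0 < k -> poincare_killed q (L - 1) k -> Trel q L <= k.
Proof. intros Hq HL Hk HP. now apply (Trel_spec q L k). Qed.

Lemma full_mass_le (q : R) (n : nat) (v : list bool -> R) :
  0 < q < 1 -> (1 - q) ^ n * v (repeat true n) ^ 2 <= Epi q n (fun s => v s ^ 2).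
Proof.
  intros Hq. revert v; induction n as [|n IH]; intros v.
  - rewrite Epi_0. simpl. lra.
  - rewrite Epi_S. assert (H1 := IH (fun s => v (true :: s))). cbv beta in H1.
    assert (H0 : 0 <= Epi q n (fun s => v (false :: s) ^ 2))
      by (apply Epi_nonneg; [assumption|]; intros; apply pow2_ge_0).
    cbn [repeat]. rewrite <- tech_pow_Rmult.
    apply (Rmult_le_compat_l (1 - q)) in H1; [|lra]. nra.
Qed.

(** Test with [pin v]: its variance is at least q (1 - q) E(v^2), its energy at most q e, and E(v^2)
    is at least the weight (1 - q)^(L - 1) of the full configuration. *)
Lemma Trel_ge_barrier (q : R) (L : nat) (e : R) :
  0 < q < 1 -> (1 <= L)%nat -> 0 < e -> barrier q (L - 1) e -> (1 - q) ^ L / e <= Trel q L.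
Proof.
  intros Hq HL He (v & H1 & Hv & Hk).
  destruct (poincare_killed_exists q (L - 1) Hq) as (k & Hkp & HP).
  destruct (Trel_spec q L k Hq HL Hkp HP) as (HT & _ & HV).
  specialize (HV (pin v)). rewrite Dir_dirichlet in HV.
  set (n := (L - 1)%nat) in *. replace L with (n + 1)%nat in HV |- * by lia.
  replace (n + 1)%nat with L in HV |- * at 2 by lia.
  assert (HD := dirichlet_pin_le q n v Hq).
  assert (HE : q * (1 - q) * Epi q n (fun s => v s ^ 2) <= Varpi q (n + 1) (pin v)).
  { assert (HN := Varpi_nonneg q n v Hq).
    unfold Varpi in *. rewrite !Epi_snoc.
    rewrite (Epi_ext q n (fun s => (1 - q) * pin v (s ++ [true]) ^ 2 + q * pin v (s ++ [false]) ^ 2)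
      (fun s => q * v s ^ 2)).
    2:{ intros s _. unfold pin. rewrite !last_last, removelast_last. ring. }
    rewrite (Epi_ext q n (fun s => (1 - q) * pin v (s ++ [true]) + q * pin v (s ++ [false]))
      (fun s => q * v s)).
    2:{ intros s _. unfold pin. rewrite !last_last, removelast_last. ring. }
    rewrite !Epi_scal. nra. }
  assert (HF := full_mass_le q n v Hq). rewrite H1 in HF.
  replace (n + 1)%nat with L in * by lia.
  assert (HB : q * (1 - q) ^ L <= q * (Trel q L * e)).
  { replace L with (S n) at 1 by lia. rewrite <- tech_pow_Rmult.
    apply (Rmult_le_compat_l (q * (1 - q))) in HF; [|nra].
    assert (Trel q L * dirichlet q L false (pin v) <= Trel q L * (q * e)).
    { apply Rmult_le_compat_l; [lra|]. apply (Rmult_le_compat_l q) in Hk; lra. }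
    lra. }
  apply Rmult_le_reg_r with e; [lra|].
  replace ((1 - q) ^ L / e * e) with ((1 - q) ^ L) by (field; lra).
  apply Rmult_le_reg_l with q; lra.
Qed.

(** [c] is the infimum of the killed form over normalised functions. The 2 spares showing that it is
    attained; positivity comes from a Poincaré constant together with the weight of the full
    configuration. *)
Lemma capacity_exists (q : R) (n : nat) :
  0 < q < 1 ->
  exists c, 0 < c /\ barrier q n (2 * c) /\
    (forall v, c * v (repeat true n) ^ 2 <= killed q n false v).
Proof.
  intros Hq.
  destruct (poincare_killed_exists q n Hq) as (k & Hk & HP).
  assert (Hp : 0 < (1 - q) ^ n) by (apply pow_lt; lra).
  set (E := fun x => exists v, v (repeat true n) = 1 /\ x = - killed q n false v).
  assert (Hub : forall x, E x -> x <= - ((1 - q) ^ n / k)).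
  { intros x (v & Hv & ->). assert (HF := full_mass_le q n v Hq). rewrite Hv in HF.
    assert (H := HP v). apply Ropp_le_contravar. apply Rmult_le_reg_l with k; [lra|].
    replace (k * ((1 - q) ^ n / k)) with ((1 - q) ^ n) by (field; lra). lra. }
  destruct (completeness E) as [m [Hm1 Hm2]].
  - exists (- ((1 - q) ^ n / k)). intros x Hx. now apply Hub.
  - exists (- killed q n false (fun _ => 1)). now exists (fun _ => 1).
  - assert (Hc : 0 < - m).
    { assert (H := Hm2 _ Hub). assert (0 < (1 - q) ^ n / k) by (apply Rdiv_lt_0_compat; lra). lra. }
    exists (- m). split; [assumption|split].
    + destruct (classic (exists v, v (repeat true n) = 1 /\ killed q n false v <= 2 * - m))
        as [(v & Hv & Hle)|Hno].
      * apply (barrier_weaken q n n (killed q n false v)); [assumption|lia|assumption|].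
        now apply barrier_of_normalised.
      * assert (H : m <= 2 * m); [|lra]. apply Hm2. intros x (v & Hv & ->).
        destruct (Rle_dec (killed q n false v) (2 * - m)); [exfalso; eauto|lra].
    + intros v. set (a := v (repeat true n)).
      assert (HN := killed_nonneg q n false v Hq).
      destruct (Req_dec a 0) as [E0|E0]; [rewrite E0; lra|].
      assert (Ha : 0 < a ^ 2) by (assert (0 <= a ^ 2) by apply pow2_ge_0;
        assert (a ^ 2 <> 0) by (now apply pow_nonzero); lra).
      assert (H1 : - killed q n false (fun s => v s / a) <= m).
      { apply Hm1. exists (fun s => v s / a). split; [|reflexivity]. fold a. now field. }
      assert (H2 : killed q n false (fun s => v s / a) <= / a ^ 2 * killed q n false v).
      { unfold killed. rewrite Rmult_plus_distr_l. apply Rplus_le_compat.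
        - assert (HC := dirichlet_contract q n false (/ a ^ 2) (fun s => v s / a) v (fun _ => 0) Hq).
          rewrite dirichlet_const, Rmult_0_r, Rplus_0_r in HC. apply HC.
          intros x y _ _. right. field. assumption.
        - unfold exit_mass. rewrite <- Epi_scal. apply Epi_le; [assumption|]. intros s _.
          destruct last_site; [lra|]. right. field. assumption. }
      apply Rmult_le_reg_l with (/ a ^ 2); [now apply Rinv_0_lt_compat|].
      replace (/ a ^ 2 * (- m * a ^ 2)) with (- m) by (field; assumption). lra.
Qed.

(** Strong induction: [mass_le_full_config] passes on the constant m / c of the shorter blocks, and
    the capacity bounds the full-configuration term at an extra 1 / c. The loss is thus linear in
    the length. *)
Lemma poincare_killed_capacity (q : R) (n : nat) (c : R) :
  0 < q < 1 -> 0 < c ->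
  (forall v, c * v (repeat true n) ^ 2 <= killed q n false v) ->
  forall m, (m <= n)%nat -> poincare_killed q m (INR (S m) / c).
Proof.
  intros Hq Hc Hcap m.
  induction m as [m IH] using (well_founded_induction lt_wf). intros Hm v.
  assert (Hk : 0 <= INR m / c)
    by (apply Rmult_le_pos; [apply pos_INR|apply Rlt_le, Rinv_0_lt_compat; lra]).
  assert (HM := mass_le_full_config q m false (INR m / c) v Hq Hk).
  assert (HC := Hcap (fun s => v (skipn (n - m) s))). cbv beta in HC.
  replace (repeat true n) with (repeat true (n - m) ++ repeat true m) in HC
    by (rewrite <- repeat_app; f_equal; lia).
  rewrite skipn_app, repeat_length, Nat.sub_diag, skipn_all2 in HC
    by (rewrite repeat_length; lia).
  cbn [app skipn] in HC.
  assert (HS := killed_skipn q (n - m) m false v Hq).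
  replace (n - m + m)%nat with n in HS by lia.
  assert (HV : v (repeat true m) ^ 2 <= 1 / c * killed q m false v).
  { apply Rmult_le_reg_l with c; [lra|].
    replace (c * (1 / c * killed q m false v)) with (killed q m false v) by (field; lra). lra. }
  rewrite S_INR. replace ((INR m + 1) / c) with (1 / c + INR m / c) by (field; lra).
  rewrite Rmult_plus_distr_r. eapply Rle_trans; [apply HM|lra].
  intros m' Hm' w. eapply Rle_trans; [apply IH; lia|].
  apply Rmult_le_compat_r; [now apply killed_nonneg|].
  apply Rmult_le_compat_r; [apply Rlt_le, Rinv_0_lt_compat; lra|]. apply le_INR. lia.
Qed.

(** * Iterated doubling and lengths independent of [q] *)

(** The cost factors grow with the block; all are bounded by the one for the final length. *)
Lemma barrier_iter (q : R) (n k : nat) (e : R) :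
  0 < q < 1 -> (1 <= n)%nat -> 0 <= e -> barrier q n e ->
  barrier q (2 ^ k * n) ((4 * INR (2 ^ k * n) * q) ^ k * e).
Proof.
  intros Hq Hn He HB. induction k as [|k IH].
  - simpl. rewrite Nat.add_0_r. now rewrite Rmult_1_l.
  - set (N := (2 ^ k * n)%nat) in *.
    assert (Hp : (1 <= 2 ^ k)%nat) by (apply Nat.neq_0_lt_0, Nat.pow_nonzero; lia).
    assert (HN : (1 <= N)%nat) by (unfold N; nia).
    replace (2 ^ S k * n)%nat with (N + N)%nat by (unfold N; simpl; lia).
    apply (barrier_weaken q (N + N) (N + N) (4 * INR N * q * ((4 * INR N * q) ^ k * e)));
      [assumption|lia| |now apply barrier_double].
    assert (H0 : 0 <= INR N) by apply pos_INR.
    rewrite <- Rmult_assoc, tech_pow_Rmult. apply Rmult_le_compat_r; [assumption|].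
    apply pow_incr. rewrite plus_INR. nra.
Qed.

Lemma Trel_fixed_upper (q : R) (L : nat) :
  0 < q < 1 -> (1 <= L)%nat -> Trel q L <= (2 / q) ^ Nat.log2_up L.
Proof.
  intros Hq HL. assert (H2 : 0 < 2 / q) by (apply Rdiv_lt_0_compat; lra).
  apply Trel_le; [assumption..|now apply pow_lt|].
  apply (poincare_killed_le q (L - 1) (2 ^ Nat.log2_up L - 1));
    [assumption| |apply pow_le; lra|now apply poincare_killed_pow2].
  destruct (Nat.eq_dec L 1) as [->|]; [simpl; lia|].
  assert (H := Nat.log2_up_spec L ltac:(lia)). lia.
Qed.

Lemma Trel_fixed_lower (L : nat) :
  (1 <= L)%nat ->
  exists c, 0 < c /\ forall q, 0 < q < 1/2 -> c / q ^ Nat.log2_up L <= Trel q L.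
Proof.
  intros HL.
  assert (HB : exists C, 0 < C /\ forall q, 0 < q < 1 -> barrier q (L - 1) (C * q ^ Nat.log2_up L)).
  { destruct (Nat.eq_dec L 1) as [->|HL1].
    - exists 1. split; [lra|]. intros q Hq. simpl. rewrite Rmult_1_l. apply barrier_0.
    - assert (H := Nat.log2_up_spec L ltac:(lia)).
      assert (Hpos : (0 < Nat.log2_up L)%nat) by (apply Nat.log2_up_pos; lia).
      (* [2 ^ m < L], so a barrier on [2 ^ m] sites fits into [L - 1]. The initial cost [q] and [m]
         doublings give the power [S m]. *)
      set (m := Nat.pred (Nat.log2_up L)) in *.
      replace (Nat.log2_up L) with (S m) by lia.
      exists ((4 * INR (2 ^ m)) ^ m). split.
      + apply pow_lt. assert (0 < INR (2 ^ m)); [|lra]. apply lt_0_INR.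
        apply Nat.neq_0_lt_0, Nat.pow_nonzero; lia.
      + intros q Hq. assert (HB := barrier_iter q 1 m q Hq (le_n 1) ltac:(lra) (barrier_1 q Hq)).
        rewrite Nat.mul_1_r in HB.
        apply (barrier_weaken q (2 ^ m) (L - 1) ((4 * INR (2 ^ m) * q) ^ m * q));
          [assumption|lia| |assumption].
        right. rewrite !Rpow_mult_distr. simpl. ring. }
  destruct HB as (C & HC & HB). exists ((1 / 2) ^ L / C). split.
  - apply Rdiv_lt_0_compat; [apply pow_lt; lra|assumption].
  - intros q Hq. assert (Hq' : 0 < q < 1) by lra.
    assert (Hqp : 0 < q ^ Nat.log2_up L) by (apply pow_lt; lra).
    eapply Rle_trans; [|apply (Trel_ge_barrier q L (C * q ^ Nat.log2_up L));
      [assumption..|nra|now apply HB]].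
    replace ((1 / 2) ^ L / C / q ^ Nat.log2_up L)
      with ((1 / 2) ^ L / (C * q ^ Nat.log2_up L)) by (field; lra).
    apply Rmult_le_compat_r; [apply Rlt_le, Rinv_0_lt_compat; nra|].
    apply pow_incr. lra.
Qed.

Lemma Rpower_le_of_le_root (x y b : R) :
  0 < x -> 0 < y -> 0 < b -> x <= Rpower y (/ b) -> Rpower x b <= y.
Proof.
  intros Hx Hy Hb H.
  rewrite <- (Rpower_1 y) by assumption. rewrite <- (Rinv_l b) by lra. rewrite <- Rpower_mult.
  apply Rle_Rpower_l; [lra|split; assumption].
Qed.

Lemma pow_antitone (x : R) (m n : nat) : 0 < x < 1 -> (m <= n)%nat -> x ^ n <= x ^ m.
Proof.
  intros Hx Hmn. induction Hmn as [|n Hmn IH]; [lra|].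
  assert (0 < x ^ n) by (apply pow_lt; lra). rewrite <- tech_pow_Rmult. nra.
Qed.

Lemma succ_fixed_iff (L L' : nat) :
  (1 <= L)%nat -> (1 <= L')%nat ->
  (succ (fun q => Trel q L') (fun q => Trel q L) <-> (Nat.log2_up L' > Nat.log2_up L)%nat).
Proof.
  intros HL HL'. set (n := Nat.log2_up L). set (n' := Nat.log2_up L').
  destruct (Trel_fixed_lower L HL) as (c1 & Hc1 & Hlow). fold n in Hlow.
  destruct (Trel_fixed_lower L' HL') as (c2 & Hc2 & Hlow'). fold n' in Hlow'.
  assert (Hup : forall q, 0 < q < 1/2 -> Trel q L <= 2 ^ n / q ^ n).
  { intros q Hq. assert (H := Trel_fixed_upper q L ltac:(lra) HL). fold n in H.
    unfold Rdiv in H. now rewrite Rpow_mult_distr, pow_inv in H. }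
  assert (Hup' : forall q, 0 < q < 1/2 -> Trel q L' <= 2 ^ n' / q ^ n').
  { intros q Hq. assert (H := Trel_fixed_upper q L' ltac:(lra) HL'). fold n' in H.
    unfold Rdiv in H. now rewrite Rpow_mult_distr, pow_inv in H. }
  assert (H2n : 0 < 2 ^ n) by (apply pow_lt; lra).
  assert (H2n' : 0 < 2 ^ n') by (apply pow_lt; lra).
  split.
  - intros (beta & Hb & c & Hc & delta & Hd & H).
    destruct (Nat.le_gt_cases n' n) as [Hle|]; [exfalso|lia].
    set (M := 2 ^ n' / c1). assert (HM : 0 < M) by (now apply Rdiv_lt_0_compat).
    (* Makes q^beta M at most c / 2, against the lower bound [c] demanded by [succ]. *)
    set (y := c / (2 * M)). assert (Hy : 0 < y) by (apply Rdiv_lt_0_compat; lra).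
    set (q := Rmin (Rmin (delta / 2) (1 / 4)) (Rpower y (/ beta))).
    assert (Hqd : q <= delta / 2) by (eapply Rle_trans; [apply Rmin_l|apply Rmin_l]).
    assert (Hq4 : q <= 1 / 4) by (eapply Rle_trans; [apply Rmin_l|apply Rmin_r]).
    assert (Hqy : q <= Rpower y (/ beta)) by apply Rmin_r.
    assert (Hq0 : 0 < q).
    { unfold q. repeat apply Rmin_glb_lt; try lra. apply exp_pos. }
    assert (Hpow := Rpower_le_of_le_root q y beta Hq0 Hy Hb Hqy).
    specialize (H q ltac:(lra)). specialize (Hlow q ltac:(lra)). specialize (Hup' q ltac:(lra)).
    assert (Hqn : 0 < q ^ n) by (apply pow_lt; lra).
    assert (Hqn' : 0 < q ^ n') by (apply pow_lt; lra).
    assert (HT : 0 < Trel q L) by (apply Trel_pos; [lra|assumption]).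
    assert (HT' : 0 < Trel q L') by (apply Trel_pos; [lra|assumption]).
    assert (Hmono : q ^ n <= q ^ n') by (apply pow_antitone; [lra|assumption]).
    assert (Hratio : Trel q L' <= M * Trel q L).
    { eapply Rle_trans; [exact Hup'|]. apply Rle_trans with (M * (c1 / q ^ n)).
      - unfold M. replace (2 ^ n' / c1 * (c1 / q ^ n)) with (2 ^ n' / q ^ n) by (field; lra).
        apply Rmult_le_compat_l; [lra|]. now apply Rinv_le_contravar.
      - apply Rmult_le_compat_l; lra. }
    assert (Hfin : c * Trel q L <= c / 2 * Trel q L).
    { apply (Rmult_le_compat_r (Trel q L)) in H; [|lra].
      replace (Rpower q beta * Trel q L' / Trel q L * Trel q L) with (Rpower q beta * Trel q L') in H
        by (field; lra).
      eapply Rle_trans; [exact H|].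
      replace (c / 2 * Trel q L) with (y * (M * Trel q L)) by (unfold y; field; lra).
      apply Rmult_le_compat; try lra. apply Rlt_le, exp_pos. }
    nra.
  (* The orders are integer powers of [1 / q], so distinct ones differ by at least one factor
     [1 / q]. *)
  - intros Hgt. exists 1. split; [lra|]. exists (c2 / 2 ^ n).
    split; [now apply Rdiv_lt_0_compat|]. exists (1 / 2). split; [lra|]. intros q Hq.
    rewrite Rpower_1 by lra.
    specialize (Hup q Hq). specialize (Hlow' q Hq).
    assert (Hqn : 0 < q ^ n) by (apply pow_lt; lra).
    assert (Hqn' : 0 < q ^ n') by (apply pow_lt; lra).
    assert (HT : 0 < Trel q L) by (apply Trel_pos; [lra|assumption]).
    assert (Hmono : q ^ n' <= q * q ^ n).
    { rewrite tech_pow_Rmult. apply pow_antitone; [lra|lia]. }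
    assert (HT' : c2 / q ^ n <= q * Trel q L').
    { apply Rle_trans with (q * (c2 / q ^ n')); [|apply Rmult_le_compat_l; lra].
      apply Rle_trans with (q * (c2 / (q * q ^ n))); [right; field; lra|].
      apply Rmult_le_compat_l; [lra|]. apply Rmult_le_compat_l; [lra|].
      now apply Rinv_le_contravar. }
    apply Rmult_le_reg_r with (Trel q L); [assumption|].
    replace (q * Trel q L' / Trel q L * Trel q L) with (q * Trel q L') by (field; lra).
    eapply Rle_trans; [|exact HT'].
    replace (c2 / q ^ n) with (c2 / 2 ^ n * (2 ^ n / q ^ n)) by (field; lra).
    apply Rmult_le_compat_l; [|assumption]. apply Rlt_le. now apply Rdiv_lt_0_compat.
Qed.

(** * Lengths of order q^(-gamma) *)

Lemma nfloor_bounds (x : R) : 0 <= x -> INR (nfloor x) <= x < INR (nfloor x) + 1.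
Proof.
  intros Hx. unfold nfloor. destruct (base_Int_part x) as [H1 H2].
  assert (Hz : (-1 < Int_part x)%Z) by (apply lt_IZR; lra).
  rewrite INR_IZR_INZ, Z2Nat.id by lia. lra.
Qed.

Lemma nfloor_INR (n : nat) : nfloor (INR n) = n.
Proof. unfold nfloor. rewrite Int_part_INR. apply Nat2Z.id. Qed.

Lemma bernoulli_lower (q : R) (n : nat) : 0 < q < 1 -> 1 - INR n * q <= (1 - q) ^ n.
Proof.
  intros Hq. induction n as [|n IH]; [simpl; lra|]. rewrite S_INR, <- tech_pow_Rmult.
  assert (0 <= INR n) by apply pos_INR. nra.
Qed.

(** Doubling [L] gains [1 / (4 q L)] in the barrier, [k] times; the comparison of [Trel] with the
    inverse capacity loses a factor [L], whence the condition [gamma < k (1 - gamma)]. *)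
Lemma part_ii_pow2 (gamma : R) (k : nat) :
  0 < gamma < 1 -> gamma < INR k * (1 - gamma) -> part_ii gamma (INR (2 ^ k)).
Proof.
  intros Hg Hk d Hd.
  assert (HP : 1 <= INR (2 ^ k)).
  { apply (le_INR 1). apply Nat.neq_0_lt_0, Nat.pow_nonzero; lia. }
  set (P := INR (2 ^ k)) in *.
  assert (HPd : 0 < 4 * P * d) by nra.
  exists (INR k * (1 - gamma) - gamma). split; [lra|].
  (* The 4 collects the 2 of [capacity_exists] and the 1/2 bounding the weight of the full
     configuration from below; [d] comes from the loss of a factor [L]. *)
  exists (1 / (4 * d * (4 * P * d) ^ k)).
  assert (Hpow : 0 < (4 * P * d) ^ k) by (now apply pow_lt).
  split; [apply Rdiv_lt_0_compat; nra|].
  (* The second bound gives [L >= 2], so that the block of [L - 1] sites is nonempty; the third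
     gives P L q <= 1/2, which keeps the weight of the full configuration at least 1/2. *)
  set (delta := Rmin (Rmin (1 / 2) (Rpower (d / 2) (/ gamma)))
                     (Rpower (1 / (2 * P * d)) (/ (1 - gamma)))).
  exists delta. split.
  { unfold delta. repeat apply Rmin_glb_lt; try lra; apply exp_pos. }
  intros q [Hq0 Hqd].
  assert (Hq1 : q < 1 / 2) by (eapply Rlt_le_trans; [exact Hqd|];
    eapply Rle_trans; [apply Rmin_l|apply Rmin_l]).
  assert (Hu : Rpower q gamma <= d / 2).
  { apply Rpower_le_of_le_root; try lra. eapply Rle_trans; [left; exact Hqd|].
    eapply Rle_trans; [apply Rmin_l|apply Rmin_r]. }
  assert (Hw : Rpower q (1 - gamma) <= 1 / (2 * P * d)).
  { apply Rpower_le_of_le_root; try lra; [apply Rdiv_lt_0_compat; nra|].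
    eapply Rle_trans; [left; exact Hqd|apply Rmin_r]. }
  assert (Huw : Rpower q gamma * Rpower q (1 - gamma) = q).
  { rewrite <- Rpower_plus. replace (gamma + (1 - gamma)) with 1 by ring. now apply Rpower_1. }
  assert (Hbeta : Rpower q (INR k * (1 - gamma) - gamma)
                  = Rpower q (1 - gamma) ^ k / Rpower q gamma).
  { unfold Rminus at 1. rewrite Rpower_plus, Rpower_Ropp. unfold Rdiv. f_equal.
    rewrite <- Rpower_pow by apply exp_pos. rewrite Rpower_mult. f_equal. ring. }
  rewrite Hbeta.
  assert (Hu0 : 0 < Rpower q gamma) by apply exp_pos.
  assert (Hw0 : 0 < Rpower q (1 - gamma)) by apply exp_pos.
  set (u := Rpower q gamma) in *. set (w := Rpower q (1 - gamma)) in *.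
  set (x := d / u).
  assert (Hxu : x * u = d) by (unfold x; field; lra).
  assert (Hx2 : 2 <= x) by (apply Rmult_le_reg_r with u; lra).
  destruct (nfloor_bounds x ltac:(lra)) as [HLx HxL].
  set (L := nfloor x) in *.
  assert (HL : (2 <= L)%nat).
  { assert (INR 1 < INR L) by (simpl; lra). apply INR_lt in H. lia. }
  replace (P * INR L) with (INR (2 ^ k * L)) by apply mult_INR.
  rewrite nfloor_INR.
  assert (Hq : 0 < q < 1) by lra.
  assert (Hxq : x * q = d * w) by (rewrite <- Huw, <- Hxu; ring).
  assert (Hpk : (1 <= 2 ^ k)%nat) by (apply Nat.neq_0_lt_0, Nat.pow_nonzero; lia).
  assert (HPw : P * (d * w) <= 1 / 2).
  { apply (Rmult_le_compat_l (P * d)) in Hw; [|nra].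
    replace (P * d * (1 / (2 * P * d))) with (1 / 2) in Hw by (field; lra). lra. }
  (* This single [c] enters both [Hupper] and [Hlower], and cancels in the ratio. *)
  destruct (capacity_exists q (L - 1) Hq) as (c & Hc & HB & Hcap).
  assert (Hupper : Trel q L <= x / c).
  { apply Rle_trans with (INR L / c).
    - apply Trel_le; [assumption|lia| |].
      + apply Rdiv_lt_0_compat; [apply lt_0_INR; lia|assumption].
      + replace L with (S (L - 1)) at 2 by lia.
        now apply (poincare_killed_capacity q (L - 1) c).
    - apply Rmult_le_compat_r; [apply Rlt_le; now apply Rinv_0_lt_compat|assumption]. }
  set (e := (4 * P * d * w) ^ k * (2 * c)).
  assert (Hwk : 0 < w ^ k) by (now apply pow_lt).
  assert (He : e = (4 * P * d) ^ k * w ^ k * (2 * c)) by (unfold e; now rewrite Rpow_mult_distr).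
  assert (He0 : 0 < e) by (rewrite He; apply Rmult_lt_0_compat; [nra|lra]).
  assert (Hlower : 1 / 2 / e <= Trel q (2 ^ k * L)).
  { apply Rle_trans with ((1 - q) ^ (2 ^ k * L) / e).
    - apply Rmult_le_compat_r; [apply Rlt_le; now apply Rinv_0_lt_compat|].
      assert (Hb := bernoulli_lower q (2 ^ k * L) Hq). rewrite mult_INR in Hb. fold P in Hb.
      assert (P * INR L * q <= 1 / 2); [|lra].
      apply Rle_trans with (P * (x * q)); [|now rewrite Hxq].
      rewrite Rmult_assoc. apply Rmult_le_compat_l; [lra|]. apply Rmult_le_compat_r; lra.
    - apply Trel_ge_barrier; [assumption|nia|assumption|].
      assert (HI := barrier_iter q (L - 1) k (2 * c) Hq ltac:(lia) ltac:(lra) HB).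
      revert HI. apply barrier_weaken; [assumption|nia|].
      apply Rmult_le_compat_r; [lra|]. apply pow_incr. rewrite mult_INR. fold P.
      assert (HI1 : INR (L - 1) <= x).
      { eapply Rle_trans; [apply le_INR|exact HLx]. lia. }
      assert (HI0 : 0 <= INR (L - 1)) by apply pos_INR.
      split; [repeat apply Rmult_le_pos; lra|].
      replace (4 * P * d * w) with (4 * P * (x * q)) by (rewrite Hxq; ring).
      replace (4 * (P * INR (L - 1)) * q) with (4 * P * (INR (L - 1) * q)) by ring.
      apply Rmult_le_compat_l; [lra|]. apply Rmult_le_compat_r; lra. }
  assert (HT : 0 < Trel q L) by (apply Trel_pos; [assumption|lia]).
  apply Rmult_le_reg_r with (Trel q L); [assumption|].
  replace (w ^ k / u * Trel q (2 ^ k * L) / Trel q L * Trel q L)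
    with (w ^ k / u * Trel q (2 ^ k * L)) by (field; lra).
  apply Rle_trans with (1 / (4 * d * (4 * P * d) ^ k) * (x / c)).
  - apply Rmult_le_compat_l; [|assumption]. apply Rlt_le, Rdiv_lt_0_compat; nra.
  - apply Rle_trans with (w ^ k / u * (1 / 2 / e)).
    + right. rewrite He. unfold x. field. lra.
    + apply Rmult_le_compat_l; [|assumption]. apply Rlt_le. now apply Rdiv_lt_0_compat.
Qed.

Theorem mainTheorem3 :
  (forall L L' : nat, (1 <= L)%nat -> (1 <= L')%nat ->
     (succ (fun q => Trel q L') (fun q => Trel q L) <->
      (Nat.log2_up L' > Nat.log2_up L)%nat))
  /\
  (forall gamma, 0 < gamma < 1 -> exists lambda, 1 < lambda /\ part_ii gamma lambda)
  /\
  (forall gamma, 0 < gamma < 1/2 -> part_ii gamma 2).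
Proof.
  split; [exact succ_fixed_iff|split].
  - intros gamma Hg.
    (* [k] depends on [gamma] alone, so [lambda] serves every [d]. For [gamma < 1/2], one doubling
       already suffices. *)
    destruct (INR_unbounded (gamma / (1 - gamma))) as [k Hk].
    assert (Hk' : gamma < INR k * (1 - gamma)).
    { apply (Rmult_lt_compat_r (1 - gamma)) in Hk; [|lra].
      replace (gamma / (1 - gamma) * (1 - gamma)) with gamma in Hk by (field; lra). lra. }
    exists (INR (2 ^ k)). split; [|now apply part_ii_pow2].
    destruct k as [|k]; [simpl in Hk'; lra|].
    apply (lt_INR 1). simpl.
    assert (2 ^ k <> 0)%nat by (apply Nat.pow_nonzero; lia). lia.
  - intros gamma Hg. replace 2 with (INR (2 ^ 1)) by (simpl; lra).
    apply part_ii_pow2; [lra|simpl; lra].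
Qed.
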